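(* The following hold (each ''there exists'' refers to a hypergraph): (P1) For each property $Q\in\{\text{JM},(B),(C)\}$ there exists a hypergraph satisfying (A) but not $Q$. (P2) For each $Q\in\{(A),(C)\}$ there exists a hypergraph satisfying (B) but not $Q$. (P3) For each $Q\in\{(A),(B)\}$ there exists a hypergraph satisfying (C) but not $Q$. (P4) There exists a hypergraph satisfying (A) and (B) that is not JM, and there exists one satisfying (A) and (B) but not (C). (P5) There exists a hypergraph satisfying (B) and (C) that is not JM, and there exists one satisfying (B) and (C) but not (A). (P6) There exists a hypergraph satisfying (A) and (C) that is not JM, and there exists one satisfying (A) and (C) but not (B). (P7) There exists a JM hypergraph satisfying (B) but not (C).
   Context: A hypergraph on a finite set $V$ is a family $\mathcal{H}\subseteq 2^V$ of nonempty subsets (edges) with $\bigcup_{H\in\mathcal{H}}H=V$. Positions are $\mathbf{x}\in\mathbb{Z}_{+}^V$. In Nim$_\mathcal{H}$ (two players alternate, a player unable to move loses) a move $\mathbf{x}\to\mathbf{x}'$ chooses $H\in\mathcal{H}$ and sets $x'_i<x_i$ for $i\in H$, $x'_i=x_i$ for $i\notin H$. Sprague–Grundy function: $\mathcal{G}(\mathbf{x})=\mathrm{mex}\{\mathcal{G}(\mathbf{x}')\mid\mathbf{x}\to\mathbf{x}'\}$. Height $h_\mathcal{H}(\mathbf{x})$: maximum number of consecutive moves from $\mathbf{x}$. $m(\mathbf{x})=\min_i x_i$, $y_\mathcal{H}(\mathbf{x})=h_\mathcal{H}(\mathbf{x}-m(\mathbf{x})\mathbf{e})$ with $\mathbf{e}$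 the all-ones vector. $v(m,y)=\binom{y+1}{2}+((m-\binom{y+1}{2}-1)\bmod(y+1))$; $\mathcal{U}(m,y,h)=h$ if $m\leq\binom{y+1}{2}$ and $v(m,y)$ otherwise. $\mathcal{H}$ is JM if $\mathcal{G}(\mathbf{x})=\mathcal{U}(m(\mathbf{x}),y_\mathcal{H}(\mathbf{x}),h_\mathcal{H}(\mathbf{x}))$ for all positions $\mathbf{x}$. (A): an edge is transversal if it meets every edge; $\mathcal{H}_S=\{H\in\mathcal{H}\mid H\subseteq S\}$; (A) means $\mathcal{H}$ has no transversal edge but for every proper $S\subsetneq V$ with $\mathcal{H}_S\neq\emptyset$, $\mathcal{H}_S$ has an edge meeting all edges of $\mathcal{H}_S$. (B): for every position $\mathbf{x}$ with $m(\mathbf{x})>0$ there is a move $\mathbf{x}\to\mathbf{x}'$ with $m(\mathbf{x}')<m(\mathbf{x})$, $h_\mathcal{H}(\mathbf{x}')=h_\mathcal{H}(\mathbf{x})-1$, and $x_i-x'_i\leq 1$ for all $i$. (C): for any two distinct edges $H,H'$ there are edges $H=H_0,\dots,H_q=H'$ with $H_{i+1}\cap H_i\neq\emptyset$, $|H_{i+1}\setminus H_i|=1$, $H_i\subseteq H_0\cup H_q$ for $i=0,\dots,q-1$. *)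

(* Defs.v *)
From mathcomp Require Import all_boot.

Set Implicit Arguments.
Unset Strict Implicit.
Unset Printing Implicit Defensive.

(* V must be nonempty for the minimum of a position to make sense. *)
Record hypergraph (V : finType) := Hypergraph {
  edges : {set {set V}};
  vertices_gt0 : 0 < #|V|;
  edges_nonempty : set0 \notin edges;
  edges_cover : cover edges = [set: V]
}.

Definition position (V : finType) := {ffun V -> nat}.

Section Nim.
Variables (V : finType) (G : hypergraph V).
Implicit Types (x y : position V) (H : {set V}).

Definition move x y : bool :=
  [exists H in edges G,
    [forall i, if i \in H then y i < x i else y i == x i]].

Definition total x : nat := \sum_i x i.

(* All positions with coordinates at most max_i x_i, filtered by [move x];
   see mem_options. *)
Definition options x : seq (position V) :=
  [seq y <- [seq [ffun i => f i : nat]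
               | f : {ffun V -> 'I_(\max_i x i).+1}] | move x y].

Lemma move_le x y i : move x y -> y i <= x i.
Proof.
case/exists_inP=> H _ /forallP/(_ i).
by case: ifP => _; [apply: ltnW | move/eqP->].
Qed.

Lemma mem_options x y : (y \in options x) = move x y.
Proof.
rewrite mem_filter; case: (boolP (move x y)) => //= mxy.
have yP i : y i < (\max_i x i).+1.
  by rewrite ltnS (leq_trans (move_le i mxy)) // leq_bigmax.
apply/mapP; exists [ffun i => Ordinal (yP i)]; first by rewrite mem_enum.
by apply/ffunP=> i; rewrite !ffunE.
Qed.

Lemma move_total x y : move x y -> total y < total x.
Proof.
move=> mxy; have le_yx i := move_le i mxy.
case/exists_inP: mxy => H GH /forallP mH.
have [i iH] : exists i, i \in H.
  by apply/set0Pn; apply: contraNneq (edges_nonempty G) => <-.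
rewrite /total (bigD1 i) //= [X in _ < X](bigD1 i) //= -addSn.
apply: leq_add; first by have := mH i; rewrite iH.
by apply: leq_sum => j _.
Qed.

Lemma mex_subproof (s : seq nat) : exists n, n \notin s.
Proof.
exists (\max_(k <- s) k).+1; apply/negP=> ks.
by have := @leq_bigmax_seq _ s xpredT id _ ks isT; rewrite ltnn.
Qed.

Definition mex (s : seq nat) : nat := ex_minn (mex_subproof s).

(* The first argument is fuel; every move decreases [total], and a position of
   total 0 is terminal, so [total x] is enough: see grundyE. *)
Fixpoint grundy_rec n x : nat :=
  if n is n'.+1 then mex [seq grundy_rec n' y | y <- options x] else 0.

Definition grundy x : nat := grundy_rec (total x) x.

Lemma grundyE x : grundy x = mex [seq grundy y | y <- options x].
Proof.
suff gE n z : total z <= n -> grundy_rec n z = mex [seq grundy y | y <- options z].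
  exact: gE.
elim/ltn_ind: n z => -[_|n IHn] z; rewrite ?leqn0.
  move/eqP=> z0; suff -> : options z = [::].
    by rewrite /= /mex; case: ex_minnP => m _ /(_ 0 isT); rewrite leqn0 => /eqP.
  case E: (options z) => [//|y s].
  have : y \in options z by rewrite E mem_head.
  by rewrite mem_options => /move_total; rewrite z0.
move=> le_zn /=; congr mex; apply/eq_in_map=> y.
rewrite mem_options => /move_total lt_yz.
have le_yn : total y <= n by rewrite -ltnS (leq_trans lt_yz).
by rewrite IHn //; apply/esym/(IHn (total y)).
Qed.

(* [walk n x]: some n consecutive moves can be made from x; see walkP. *)
Fixpoint walk n x : bool :=
  if n is n'.+1 then has (walk n') (options x) else true.

Lemma walkP n x :
  reflect (exists2 p : seq (position V), size p = n & path move x p) (walk n x).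
Proof.
elim: n x => [|n IHn] x /=; first by left; exists [::].
apply: (iffP hasP) => [[y] | [[//|y p] /= [sp] /andP[mxy py]]].
  rewrite mem_options => mxy /IHn[p sp py].
  by exists (y :: p); rewrite /= ?sp ?mxy.
by exists y; rewrite ?mem_options //; apply/IHn; exists p.
Qed.

Lemma walk0 x : exists n, walk n x.
Proof. by exists 0. Qed.

Lemma walk_total x n : walk n x -> n <= total x.
Proof.
elim: n x => //= n IHn x /hasP[y].
by rewrite mem_options => /move_total lt_yx /IHn/leq_ltn_trans; apply.
Qed.

Definition height x : nat := ex_maxn (walk0 x) (@walk_total x).

(* As V is nonempty, the default value max_i x_i does not affect the minimum;
   see minposP. *)
Definition minpos x : nat := \big[minn/(\max_i x i)]_i x i.

Lemma minposP x : (forall i, minpos x <= x i) /\ (exists i, minpos x = x i).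
Proof.
split=> [i|].
  rewrite /minpos; move: (\max_i x i) (mem_index_enum i) => d.
  elim: (index_enum V) => // j s IHs; rewrite inE big_cons geq_min.
  by case/predU1P=> [<- | /IHs ->]; rewrite ?leqnn ?orbT.
have [i iP] := eq_bigmax x (vertices_gt0 G).
rewrite /minpos; elim/big_ind: _ => [|m n [j ->] [k ->]|j _].
- by exists i.
- by rewrite /minn; case: ifP => _; [exists j | exists k].
- by exists j.
Qed.

Definition reduced_height x : nat := height [ffun i => x i - minpos x].

(* Only used for m > 'C(y.+1, 2), where the subtractions are exact. *)
Definition vJM (m y : nat) : nat :=
  'C(y.+1, 2) + (m - 'C(y.+1, 2) - 1) %% y.+1.

Definition UJM (m y h : nat) : nat :=
  if m <= 'C(y.+1, 2) then h else vJM m y.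

Definition JM : Prop :=
  forall x, grundy x = UJM (minpos x) (reduced_height x) (height x).

Definition has_transversal_edge (E : {set {set V}}) : Prop :=
  exists2 H, H \in E & forall H', H' \in E -> H :&: H' != set0.

Definition induced (E : {set {set V}}) (S : {set V}) : {set {set V}} :=
  [set H in E | H \subset S].

Definition condA : Prop :=
  ~ has_transversal_edge (edges G) /\
  forall S : {set V}, S \proper [set: V] -> induced (edges G) S != set0 ->
    has_transversal_edge (induced (edges G) S).

Definition condB : Prop :=
  forall x, 0 < minpos x ->
    exists y, [/\ move x y, minpos y < minpos x, height y = height x - 1
                & forall i, x i - y i <= 1].

Definition condC : Prop :=
  forall H H', H \in edges G -> H' \in edges G -> H != H' ->
    exists (q : nat) (F : nat -> {set V}),
      [/\ F 0 = H, F q = H', forall i, i <= q -> F i \in edges G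
        & forall i, i < q -> [/\ F i.+1 :&: F i != set0,
                                 #|F i.+1 :\: F i| = 1
                               & F i \subset H :|: H']].

End Nim.

(* Main.v *)
From mathcomp Require Import all_boot zify.
Require Import Defs.

(** Four hypergraphs separate all the properties.
    - One-pile Nim satisfies (B) and (C) but is neither (A) nor JM; two-pile Nim
      satisfies (A) and (B) but is neither JM nor (C).
    - The proper nonempty subsets of a 3-set (Jenkyns and Mayberry) form a JM
      hypergraph with (B) but not (C). Its height is the sum of the piles, and
      an option realizing a smaller value is found by fixing one pile.
    - On {0, ..., 7} put O = {0}, Z = {1, 2, 3} and W = {4, ..., 7}, and take the
      4-sets H with |H n O| + 1 <= |H n W| <= |H n O| + 2. This family is closed
      under complement, which gives (A), and has a basis-exchange property,
      which gives (C). At the position (7; 32, 32, 32; 8, 8, 8, 8) the height is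
      32, since every edge meets W and W carries 32 tokens in total; an edge
      through 0 meets W twice, so it loses too much height. Hence (B) fails.
      Options of height 31 keep the minimum 7 but drop the reduced height from 4
      to 3, so that their JM value is short; hence JM fails as well.
    A failure of JM is always detected as an inconsistency of the JM formula with
    the mex rule. *)

Set Implicit Arguments.
Unset Strict Implicit.
Unset Printing Implicit Defensive.

(** * Grundy values, heights and weights in an arbitrary hypergraph *)

Section General.
Variables (V : finType) (G : hypergraph V).
Implicit Types (x y z : position V) (H : {set V}).

Lemma moveP x y :
  reflect (exists2 H, H \in edges G &
             forall i, if i \in H then y i < x i else y i == x i)
          (move G x y).
Proof.
apply: (iffP exists_inP) => -[H HG Hxy]; exists H => //.
  exact/forallP.
exact/forallP.
Qed.

Lemma grundy_move_neq x y : move G x y -> grundy G y <> grundy G x.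
Proof.
move=> mxy eyx; have := grundyE G x; rewrite /mex; case: ex_minnP => n.
move=> nP _ e; case/negP: nP; rewrite -e -eyx; apply: map_f.
by rewrite mem_options.
Qed.

Lemma grundy_option x k :
  k < grundy G x -> exists2 y, move G x y & grundy G y = k.
Proof.
rewrite grundyE /mex; case: ex_minnP => n _ nmin lt_kn.
case: (boolP (k \in [seq grundy G y | y <- options G x])) => [|/nmin].
  by case/mapP=> y; rewrite mem_options => mxy ->; exists y.
by rewrite leqNgt lt_kn.
Qed.

(** At a first disagreement [x], the smaller of the two values is attained at an option of [x] by
    the function with the larger value. Both functions agree on options, so an option would share
    the smaller function's value at [x]. *)
Lemma grundy_unique (g : position V -> nat) :
    (forall x y, move G x y -> g y <> g x) ->
    (forall x k, k < g x -> exists2 y, move G x y & g y = k) ->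
  forall x, grundy G x = g x.
Proof.
move=> g_neq g_option x; have [n] := ubnP (total x).
elim: n x => // n IHn x; rewrite ltnS => le_xn.
have IH y : move G x y -> grundy G y = g y.
  by move=> /move_total lt_yx; apply: IHn; apply: leq_trans le_xn.
case: (ltngtP (grundy G x) (g x)) => // lt_xx.
  have [y mxy gy] := g_option _ _ lt_xx.
  by case: (grundy_move_neq mxy); rewrite IH.
have [y mxy gy] := grundy_option lt_xx.
by case: (g_neq _ _ mxy); rewrite -IH.
Qed.

Lemma walk_height x : walk G (height G x) x.
Proof. by rewrite /height; case: ex_maxnP. Qed.

Lemma walk_leq_height n x : walk G n x -> n <= height G x.
Proof. by rewrite /height; case: ex_maxnP => m _ mmax /mmax. Qed.

Lemma move_height x y : move G x y -> height G y < height G x.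
Proof.
move=> mxy; apply: walk_leq_height => /=; apply/hasP; exists y.
  by rewrite mem_options.
exact: walk_height.
Qed.

(** A position of value [k.+1] has an option of value [k], so values can be descended one move at a
    time. *)
Lemma grundy_le_height x : grundy G x <= height G x.
Proof.
have [n] := ubnP (total x); elim: n x => // n IHn x; rewrite ltnS => le_xn.
case E: (grundy G x) => [//|k].
have [y mxy <-] : exists2 y, move G x y & grundy G y = k.
  by apply: grundy_option; rewrite E.
apply: leq_ltn_trans (move_height mxy); apply: IHn.
exact: leq_trans (move_total mxy) le_xn.
Qed.

Lemma minpos_eq x m i : (forall j, m <= x j) -> x i = m -> minpos x = m.
Proof.
move=> le_mx xi; have [lex [j ej]] := minposP G x.
by apply/eqP; rewrite eqn_leq -{1}xi lex ej le_mx.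
Qed.

Definition wsum (w : V -> nat) x := \sum_i w i * x i.

Lemma wsumD w w' x : wsum (fun i => w i + w' i) x = wsum w x + wsum w' x.
Proof. by rewrite /wsum -big_split; apply: eq_bigr => i _; rewrite mulnDl. Qed.

Lemma wsum_set1 v x : wsum (fun i => i \in [set v]) x = x v.
Proof.
rewrite /wsum (bigD1 v) //= set11 mul1n big1 ?addn0 // => i /negbTE iv.
by rewrite inE iv.
Qed.

Lemma wsum_sub w x c :
    (forall i, c <= x i) ->
  wsum w [ffun i => x i - c] + (\sum_i w i) * c = wsum w x.
Proof.
move=> le_cx; rewrite /wsum big_distrl -big_split; apply: eq_bigr => i _ /=.
by rewrite ffunE -mulnDr subnK.
Qed.

Lemma wsum_le_point w x y v :
    (forall i, y i <= x i) ->
  wsum w y + w v * x v <= wsum w x + w v * y v.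
Proof.
move=> le_yx; rewrite /wsum (bigD1 v) //= [X in _ <= X + _](bigD1 v) //=.
rewrite addnAC [leqRHS]addnAC [X in _ <= X + _]addnC leq_add2l.
by apply: leq_sum => i _; rewrite leq_mul2l le_yx orbT.
Qed.

Lemma wsum_move w x y H :
    (forall i, if i \in H then y i < x i else y i == x i) ->
  wsum w y + \sum_(i in H) w i <= wsum w x.
Proof.
move=> Hxy; rewrite /wsum [X in _ + X]big_mkcond -big_split /=.
apply: leq_sum => i _; have := Hxy i; case: ifP => _; last by move/eqP->; lia.
by move=> lt_yx; rewrite -mulnSr leq_mul2l lt_yx orbT.
Qed.

(** Weak linear programming duality: each move costs at least [t] units of weight. The matching
    lower bounds come from [height_packing]. *)
Lemma height_wsum w t x :
    (forall H, H \in edges G -> t <= \sum_(i in H) w i) ->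
  height G x * t <= wsum w x.
Proof.
move=> w_ge; move: (walk_height x); move: (height G x) => n.
elim: n x => [//|n IHn] x /= /hasP[y].
rewrite mem_options => /moveP[H HG Hxy] /IHn le_n.
have := wsum_move w Hxy; have := w_ge H HG; lia.
Qed.

(** The edges of [p] are played in turn, each removing one token from each of its vertices. *)
Lemma height_packing (p : seq {set V}) x :
    all [in edges G] p -> (forall i, count (fun H => i \in H) p <= x i) ->
  size p <= height G x.
Proof.
elim: p x => //= H p IHp x /andP[HG pG] px.
have mxy : move G x [ffun i => x i - (i \in H)].
  apply/moveP; exists H => // i; rewrite ffunE; have := px i.
  by case: (i \in H) => /=; lia.
apply: leq_ltn_trans (move_height mxy); apply: IHp => // i.
by rewrite ffunE; have := px i; lia.
Qed.

Lemma total_decr x i :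
  0 < x i -> total x = (total [ffun j => x j - (j == i)]).+1.
Proof.
move=> xi; rewrite /total (bigD1 i) //= [in RHS](bigD1 i) //= ffunE eqxx.
have -> : \sum_(j | j != i) [ffun j => x j - (j == i)] j = \sum_(j | j != i) x j.
  by apply: eq_bigr => j /negbTE ji; rewrite ffunE ji subn0.
by rewrite -addSn; case: (x i) xi => //= n _; rewrite subn1.
Qed.

(** * Hypergraphs containing all singletons *)

Section Singletons.
Hypothesis G1 : forall i, [set i] \in edges G.

Lemma height_singletons x : height G x = total x.
Proof.
apply/eqP; rewrite eqn_leq; apply/andP; split.
  exact: walk_total (walk_height x).
have [n] := ubnP (total x); elim: n x => // n IHn x; rewrite ltnS => le_xn.
have [/existsP[i xi]|/existsPn x0] := boolP [exists i, 0 < x i]; last first.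
  by rewrite /total big1 // => i _; have := x0 i; case: (x i).
pose y : position V := [ffun j => x j - (j == i)].
have mxy : move G x y.
  apply/moveP; exists [set i] => // j; rewrite inE ffunE.
  by case: eqP => [->|_]; lia.
have tx : total x = (total y).+1 by exact: total_decr.
rewrite tx; apply: leq_ltn_trans (move_height mxy); apply: IHn; lia.
Qed.

(** Taking one token from a smallest pile lowers the minimum and, the height being the total, costs
    one unit of height. *)
Lemma condB_singletons : condB G.
Proof.
move=> x x_gt0; have [le_mx [i mi]] := minposP G x.
pose y : position V := [ffun j => x j - (j == i)].
exists y; split.
- apply/moveP; exists [set i] => // j; rewrite inE ffunE.
  by case: eqP => [->|_]; lia.
- have [/(_ i)] := minposP G y; rewrite ffunE eqxx; lia.
- by rewrite !height_singletons (@total_decr x i) -?mi // subn1.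
- by move=> j; rewrite ffunE; lia.
Qed.

(** In a chain ending at [[set j]], the last but one edge meets [[set j]], hence contains [j], and
    the last step adds nothing new. *)
Lemma not_condC_singletons (i j : V) : i != j -> ~ condC G.
Proof.
move=> ij /(_ [set i] [set j] (G1 i) (G1 j)).
rewrite (inj_eq set1_inj) => /(_ ij)[[|q] [F [F0 Fq _ FS]]].
  by move: ij; rewrite -(inj_eq set1_inj) -F0 -Fq eqxx.
have [/set0Pn[v]] := FS q (leqnn _); rewrite Fq !inE => /andP[/eqP-> jF] + _.
rewrite (_ : _ :\: _ = set0) ?cards0 //; apply/setP=> u; rewrite !inE.
by case: eqP => [->|_]; rewrite ?jF ?andbF.
Qed.

End Singletons.

(* Two disjoint edges would already fill the whole vertex set. *)
Lemma condA_self_complementary k :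
    #|V| = k.*2 ->
    (forall H, H \in edges G -> #|H| = k /\ ~: H \in edges G) ->
  condA G.
Proof.
move=> cardV GP; split.
  by case=> H HG /(_ _ (GP H HG).2); rewrite setICr eqxx.
move=> S /properP[_ [v _ vS]] /set0Pn[H HS]; exists H => // H' H'S.
move: HS H'S; rewrite !inE => /andP[HG HS] /andP[H'G H'S].
apply/negP=> /eqP HH'.
have : #|H :|: H'| <= #|V|.-1.
  rewrite -ltnS prednK; last by apply/card_gt0P; exists v.
  rewrite -cardsT; apply: proper_card; apply/properP; split; first exact: subsetT.
  exists v => //; apply: contra vS; rewrite inE.
  by case/orP; [apply: (subsetP HS) | apply: (subsetP H'S)].
rewrite cardsU HH' cards0 (GP H HG).1 (GP H' H'G).1 cardV.
have := vertices_gt0 G; lia.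
Qed.

(** Induction on [#|H' :\: H|]: exchanging [a] for [b] brings [H] closer to [H'], and [1 < k] leaves
    consecutive edges a common vertex. *)
Lemma condC_exchange k :
    1 < k -> (forall H, H \in edges G -> #|H| = k) ->
    (forall H H', H \in edges G -> H' \in edges G -> H != H' ->
       exists a b, [/\ a \in H :\: H', b \in H' :\: H
                     & b |: (H :\ a) \in edges G]) ->
  condC G.
Proof.
move=> k_gt1 unif exch.
suff chain n H H' : #|H' :\: H| <= n -> H \in edges G -> H' \in edges G ->
    exists (q : nat) (F : nat -> {set V}),
      [/\ F 0 = H, F q = H', forall i, i <= q -> F i \in edges G
        & forall i, i < q -> [/\ F i.+1 :&: F i != set0,
                                 #|F i.+1 :\: F i| = 1
                               & F i \subset H :|: H']].
  by move=> H H' HG H'G _; apply: chain HG H'G.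
elim: n H => [|n IHn] H le_n HG H'G; have [->|neqHH'] := eqVneq H H'.
- by exists 0, (fun=> H'); split=> // i; rewrite leqn0 => /eqP->.
- have [a [b [_ bH' _]]] := exch H H' HG H'G neqHH'.
  by move: le_n; rewrite (cardsD1 b) bH'.
- by exists 0, (fun=> H'); split=> // i; rewrite leqn0 => /eqP->.
have [a [b [aP bP KG]]] := exch H H' HG H'G neqHH'.
set K := b |: (H :\ a) in KG.
move: (aP) (bP); rewrite !inE => /andP[aH' aH] /andP[bH bH'].
have [|q [F [F0 Fq FG FS]]] := IHn K _ KG H'G.
  apply: leq_trans (_ : #|(H' :\: H) :\ b| <= n).
    apply: subset_leq_card; apply/subsetP=> v; rewrite !inE.
    by case: (eqVneq v a) => [->|va]; rewrite ?(negbTE aH') ?andbF //= negb_or andbA.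
  by move: le_n; rewrite (cardsD1 b (H' :\: H)) bP.
have KU : K :|: H' \subset H :|: H'.
  apply/subsetP=> v; rewrite !inE; case: eqP => [->|_] /=; rewrite ?bH' ?orbT //.
  by case: (v \in H); rewrite ?andbF.
exists q.+1, (fun i => if i is i'.+1 then F i' else H); split=> //.
- by case=> // i; apply: FG.
case=> [_|i /FS[? ? iU]]; last by split=> //; apply: subset_trans KU.
rewrite F0; split; last exact: subsetUl.
- have : 0 < #|H :\ a| by move: k_gt1; rewrite -(unif H HG) (cardsD1 a H) aH.
  case/card_gt0P=> v vP; apply/set0Pn; exists v.
  by move: vP; rewrite !inE => /andP[-> ->]; rewrite orbT.
- apply/eqP/cards1P; exists b; apply/setP=> v; rewrite !inE.
  by case: (eqVneq v b) => [->|_]; rewrite ?bH //= andbCA andNb andbF.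
Qed.

End General.

(** * Nim *)

Section Nim.
Variables (V : finType) (V_gt0 : 0 < #|V|).

Let nim_edges : {set {set V}} := [set [set i] | i : V].

Fact nim_nonempty : set0 \notin nim_edges.
Proof.
by apply/imsetP=> -[i _ /setP/(_ i)]; rewrite !inE eqxx.
Qed.

Fact nim_cover : cover nim_edges = [set: V].
Proof.
apply/setP=> i; rewrite inE; apply/bigcupP; exists [set i]; last exact: set11.
exact: imset_f.
Qed.

Definition nim : hypergraph V := Hypergraph V_gt0 nim_nonempty nim_cover.

Lemma nim_singletons i : [set i] \in edges nim.
Proof. exact: imset_f. Qed.

End Nim.

Fact card_bool_gt0 : 0 < #|{: bool}|. Proof. by rewrite card_bool. Qed.
Fact card_unit_gt0 : 0 < #|{: unit}|. Proof. by rewrite card_unit. Qed.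

Definition nim2 := nim card_bool_gt0.
Definition nim1 := nim card_unit_gt0.

Lemma nim2_condA : condA nim2.
Proof.
apply: (@condA_self_complementary _ _ 1); first by rewrite card_bool.
move=> H /imsetP[i _ ->]; rewrite cards1; split=> //.
rewrite (_ : ~: [set i] = [set ~~ i]); first exact: nim_singletons.
by apply/setP=> j; rewrite !inE; case: i; case: j.
Qed.

(* The option value 2 is missing at the position (1, 3), whose predicted value
   is 4. *)
Lemma nim2_not_JM : ~ JM nim2.
Proof.
move=> jm.
have min2 (x : position bool) : minpos x = minn (x true) (x false).
  apply: (minpos_eq nim2 (i := x true < x false)) => [j|].
    - by case: j; rewrite geq_min leqnn ?orbT.
    - by rewrite /minn; case: ifP.
have val2 x : grundy nim2 x = UJM (minn (x true) (x false))
    (x true + x false - (minn (x true) (x false)).*2) (x true + x false).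
  rewrite jm /reduced_height !height_singletons; try exact: nim_singletons.
  rewrite /total !big_bool /= !ffunE min2; congr UJM.
  by move: (x true) (x false) => a b; lia.
pose x : position bool := [ffun i => if i then 1 else 3].
have [|y /moveP[H /imsetP[i _ ->] Hxy]] := @grundy_option _ nim2 x 2.
  by rewrite val2 !ffunE.
move: (Hxy true) (Hxy false); rewrite val2 !inE !ffunE.
(* The options (0, 3), (1, 0), (1, 1), (1, 2) have predicted values 3, 1, 0, 3. *)
case: i {Hxy} => /= [] h1 h2.
  by rewrite (eqP h2); case: (y true) h1 => [|[]].
by rewrite (eqP h1); case: (y false) h2 => [|[|[|[]]]].
Qed.

Lemma nim1_not_condA : ~ condA nim1.
Proof.
case=> + _; apply; exists [set tt]; first exact: nim_singletons.
by move=> H' /imsetP[[] _ ->]; rewrite setIid; apply/set0Pn; exists tt; rewrite inE.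
Qed.

Lemma nim1_condC : condC nim1.
Proof. by move=> H H' /imsetP[[] _ ->] /imsetP[[] _ ->]; rewrite eqxx. Qed.

(** The reduced height is always 0, so the formula predicts 0 both for one token and for the empty
    pile, although a move joins them. *)
Lemma nim1_not_JM : ~ JM nim1.
Proof.
move=> jm; pose c n : position unit := [ffun=> n].
have minc n : minpos (c n) = n.
  by apply: (minpos_eq nim1 (i := tt)) => [j|]; rewrite ffunE.
have totc n : total (c n) = n by rewrite /total (big_pred1 tt) ?ffunE // => -[].
have redc n : [ffun i => c n i - n] = c 0 :> position unit.
  by apply/ffunP=> i; rewrite !ffunE subnn.
have mc : move nim1 (c 1) (c 0).
  apply/moveP; exists [set tt]; first exact: nim_singletons.
  by case; rewrite !inE !ffunE.
apply: (grundy_move_neq mc); rewrite !jm /reduced_height !minc !redc.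
by rewrite !height_singletons ?totc //; exact: nim_singletons.
Qed.

(** * Proper subsets of a 3-set *)

Definition proper3_edges : {set {set 'I_3}} :=
  [set H | (H != set0) && (H != setT)].

Fact proper3_vertices : 0 < #|'I_3|. Proof. by rewrite card_ord. Qed.

Fact proper3_nonempty : set0 \notin proper3_edges.
Proof. by rewrite inE eqxx. Qed.

Fact proper3_singletons i : [set i] \in proper3_edges.
Proof.
rewrite inE; apply/andP; split; first by apply/set0Pn; exists i; rewrite inE.
by rewrite eqEcard subsetT cardsT card_ord cards1.
Qed.

Fact proper3_cover : cover proper3_edges = [set: 'I_3].
Proof.
apply/setP=> i; rewrite inE; apply/bigcupP; exists [set i]; last exact: set11.
exact: proper3_singletons.
Qed.

Definition proper3 : hypergraph 'I_3 :=
  Hypergraph proper3_vertices proper3_nonempty proper3_cover.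

Lemma proper3_moveP (x y : position 'I_3) :
  reflect [/\ forall i, y i <= x i, exists i, y i = x i & exists i, y i < x i]
          (move proper3 x y).
Proof.
apply: (iffP (moveP _ _ _)) => [[H] | [le_yx [i yi] [j yj]]].
  rewrite inE => /andP[/set0Pn[j jH] HT] Hxy; split=> [i||].
  - by have := Hxy i; case: ifP => [_ /ltnW|_ /eqP->].
  - have [i iH] : exists i, i \notin H.
      apply/existsP; apply: contraR HT => /existsPn HT.
      by apply/eqP/setP=> i; rewrite inE; apply/negPn.
    by exists i; apply/eqP; have := Hxy i; rewrite (negbTE iH).
  - by exists j; have := Hxy j; rewrite jH.
exists [set k | y k < x k].
  rewrite inE; apply/andP; split; first by apply/set0Pn; exists j; rewrite inE.
  by apply/eqP=> /setP/(_ i); rewrite !inE yi ltnn.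
by move=> k; rewrite inE; case: ltnP => // ?; rewrite eqn_leq le_yx.
Qed.

(** Any enumeration [i, j, l] of the vertices can serve as coordinates; with [sorted3] the piles may
    then be taken in increasing order. *)
Lemma mem_uniq3 (i j l : 'I_3) : uniq [:: i; j; l] -> [:: i; j; l] =i predT.
Proof.
move=> u3 k.
have sub : {subset [:: i; j; l] <= enum 'I_3} by move=> v _; rewrite mem_enum.
by have [|_ ->] := uniq_min_size u3 sub; rewrite ?size_enum_ord ?mem_enum.
Qed.

Lemma total3 (x : position 'I_3) i j l :
  uniq [:: i; j; l] -> total x = x i + x j + x l.
Proof.
move=> u3; rewrite /total (perm_big [:: i; j; l]) /=.
  by rewrite !big_cons big_nil; lia.
apply: uniq_perm; rewrite ?index_enum_uniq // => k.
by rewrite mem_uniq3 // mem_index_enum.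
Qed.

Lemma minpos3 (x : position 'I_3) i j l :
  uniq [:: i; j; l] -> minpos x = minn (x i) (minn (x j) (x l)).
Proof.
move=> u3; have [le_mx [k mk]] := minposP proper3 x.
have := mem_uniq3 u3 k; rewrite !inE; have := le_mx i; have := le_mx j.
by have := le_mx l; rewrite mk => ? ? ? /or3P[] /eqP ?; subst k; lia.
Qed.

Lemma sorted3 (x : position 'I_3) :
  exists i j l, [/\ uniq [:: i; j; l], x i <= x j & x j <= x l].
Proof.
pose s := sort (relpre x leq) (enum 'I_3).
have : sorted (relpre x leq) s by apply: sort_sorted => a b; apply: leq_total.
have : uniq s by rewrite sort_uniq enum_uniq.
have : size s = 3 by rewrite size_sort size_enum_ord.
case: s => [|i [|j [|l []]]] //= _ u3 /and3P[ij jl _].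
by exists i, j, l; split.
Qed.

(** * Triangular numbers and the arithmetic of [vJM] *)

Lemma binS2 z : 'C(z.+2, 2) = 'C(z.+1, 2) + z.+1.
Proof. by rewrite binS bin1. Qed.

Lemma leq_bin2S y z : y <= z -> 'C(y.+1, 2) <= 'C(z.+1, 2).
Proof. by move=> le_yz; apply: leq_bin2l. Qed.

(** Blocks of length [z.+1] starting at the triangular numbers tile the naturals. The block of [k]
    names the only reduced height at which [vJM] can equal [k]. *)
Lemma triangular_decomposition k :
  exists z r, k = 'C(z.+1, 2) + r /\ r <= z.
Proof.
elim: k => [|k [z [r [-> le_rz]]]]; first by exists 0, 0.
have [lt_rz|ge_rz] := ltnP r z; first by exists z, r.+1; lia.
by exists z.+1, 0; rewrite binS2; lia.
Qed.

Lemma vJM_bounds m y : 'C(y.+1, 2) <= vJM m y <= 'C(y.+1, 2) + y.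
Proof. by have := @ltn_mod (m - 'C(y.+1, 2) - 1) y.+1; rewrite /vJM; lia. Qed.

Lemma vJM_lt m y : 'C(y.+1, 2) < m -> vJM m y < m.
Proof. by have := @leq_mod (m - 'C(y.+1, 2) - 1) y.+1; rewrite /vJM; lia. Qed.

Lemma vJM_inj_y m m' y y' : vJM m y = vJM m' y' -> y = y'.
Proof.
move=> e; have := vJM_bounds m y; have := vJM_bounds m' y'; rewrite e.
by case: (ltngtP y y') => // /leq_bin2S; rewrite binS2; lia.
Qed.

(* The short value [k = 'C(z.+1, 2) + r] is taken at minimum [m - d] for every
   [d] congruent to [m - k - 1] modulo [z.+1]. *)
Lemma vJM_shift m z r :
    'C(z.+1, 2) + r < m -> r <= z ->
  let d := (m - ('C(z.+1, 2) + r) - 1) %% z.+1 in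
  [/\ d <= z, 'C(z.+1, 2) + r + d < m & vJM (m - d) z = 'C(z.+1, 2) + r].
Proof.
move=> lt_km le_rz /=; set n := m - _ - 1; set d := n %% z.+1.
have ed : n = n %/ z.+1 * z.+1 + d by exact: divn_eq.
have lt_d : d < z.+1 by rewrite ltn_mod.
have le_dn : d <= n by exact: leq_mod.
split; [by [] | by move: (d) le_dn; rewrite /n => ?; lia |].
rewrite /vJM (_ : _ - 1 = n %/ z.+1 * z.+1 + r).
  by rewrite modnMDl modn_small.
move: (d) (n %/ z.+1 * z.+1) ed le_dn; rewrite /n => d' q; lia.
Qed.

(** * The Grundy function of the proper subsets of a 3-set *)

Definition value3 (x : position 'I_3) :=
  UJM (minpos x) (total x - 3 * minpos x) (total x).

Lemma JM_value3 (x : position 'I_3) :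
  UJM (minpos x) (reduced_height proper3 x) (height proper3 x) = value3 x.
Proof.
rewrite /reduced_height !height_singletons; try exact: proper3_singletons.
rewrite /value3; congr UJM.
have [i [j [l [u3 _ _]]]] := sorted3 x; rewrite !(total3 _ u3) !ffunE.
have [le_mx _] := minposP proper3 x.
by have := le_mx i; have := le_mx j; have := le_mx l; lia.
Qed.

Lemma minpos3_total (x : position 'I_3) i : x i + 2 * minpos x <= total x.
Proof.
have [j [k [l [u3 _ _]]]] := sorted3 x; have := mem_uniq3 u3 i.
have [le_mx _] := minposP proper3 x; rewrite (total3 _ u3) !inE.
have := le_mx j; have := le_mx k; have := le_mx l.
by move=> ? ? ? /or3P[] /eqP->; lia.
Qed.

(** Call a position long if its value is its total, short if it is given by [vJM]. Two long values
    differ because totals drop. A short value is below its own minimum, whereas the total of the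
    other position is not, thanks to the untouched pile [i] when [x] is the short one. *)
Lemma value3_move_neq (x y : position 'I_3) :
  move proper3 x y -> value3 y <> value3 x.
Proof.
move=> mxy; have lt_t := move_total mxy.
case/proper3_moveP: mxy => le_yx [i yi] _; rewrite /value3 /UJM.
have [le_mx [jx _]] := minposP proper3 x.
have [le_my [jy mj]] := minposP proper3 y.
have := minpos3_total x i; have := minpos3_total y i.
have := minpos3_total x jx; have := minpos3_total y jy.
have := le_mx i; have := le_my i; have := le_yx jy; have := le_mx jy.
rewrite yi -mj; set m := minpos x; set m' := minpos y.
set t := total x in lt_t *; set t' := total y in lt_t *.
move=> ? ? ? ? ? ? ? ?.
case: ifP => long'; case: ifP => long //.
- by lia.
- have : vJM m (t - 3 * m) < m by apply: vJM_lt; lia.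
  by lia.
- have : vJM m' (t' - 3 * m') < m' by apply: vJM_lt; lia.
  by lia.
move=> e; have ey := vJM_inj_y e; move: e long long'; rewrite ey /vJM.
set y0 := t - _ in ey *; move=> e long long'.
(* Both positions are short with reduced height [y0], so the minima would differ by a positive
   multiple of [y0.+1]; but the untouched pile forces [m <= m' + y0]. *)
have : m - 'C(y0.+1, 2) - 1 = m' - 'C(y0.+1, 2) - 1 %[mod y0.+1] by lia.
move/eqP; rewrite eqn_mod_dvd; last by lia.
by move/dvdn_leq; lia.
Qed.

Definition pos3 (i j : 'I_3) (p q r : nat) : position 'I_3 :=
  [ffun t => if t == i then p else if t == j then q else r].

Lemma pos3E i j l p q r : uniq [:: i; j; l] ->
  [/\ pos3 i j p q r i = p, pos3 i j p q r j = q & pos3 i j p q r l = r].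
Proof.
rewrite /= !inE negb_or andbT => /andP[/andP[ij il] jl].
by rewrite !ffunE !eqxx ![_ == i]eq_sym (negbTE ij) (negbTE il) eq_sym (negbTE jl).
Qed.

Lemma value3_pos3 i j l p q r m y : uniq [:: i; j; l] ->
    m = minn p (minn q r) -> p + q + r = y + 3 * m ->
  value3 (pos3 i j p q r) = UJM m y (p + q + r).
Proof.
move=> u3 em ey; have [ei ej el] := pos3E p q r u3.
by rewrite /value3 (total3 _ u3) (minpos3 _ u3) ei ej el -em ey addnK.
Qed.

Lemma move_pos3 i j l p q r (x : position 'I_3) : uniq [:: i; j; l] ->
    p <= x i -> q <= x j -> r <= x l ->
    [|| p == x i, q == x j | r == x l] ->
    [|| p < x i, q < x j | r < x l] ->
  move proper3 x (pos3 i j p q r).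
Proof.
move=> u3 pi qj rl eqs lts; have [ei ej el] := pos3E p q r u3.
apply/proper3_moveP; split.
- move=> k; have := mem_uniq3 u3 k; rewrite !inE.
  by case/or3P=> /eqP->; rewrite ?ei ?ej ?el.
- by case/or3P: eqs => /eqP e; [exists i | exists j | exists l]; rewrite ?ei ?ej ?el.
- by case/or3P: lts => e; [exists i | exists j | exists l]; rewrite ?ei ?ej ?el.
Qed.

(** Values [k >= a], with [a] the smallest pile, are reached at long options of total [k]; values
    [k < a] at short options whose reduced height [z] is the block of [k]. One pile is kept each
    time. *)
Lemma value3_option (x : position 'I_3) k :
  k < value3 x -> exists2 y, move proper3 x y & value3 y = k.
Proof.
have [i [j [l [u3 le_ij le_jl]]]] := sorted3 x.
have em : minpos x = x i by rewrite (minpos3 _ u3); lia.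
rewrite {1}/value3 em (total3 _ u3).
set a := x i in le_ij *; set b := x j in le_ij le_jl *; set c := x l in le_jl *.
set y := _ - 3 * a => lt_k.
have y_def : a + b + c = y + 3 * a by lia.
have [lt_ka|le_ak] := ltnP k a; last first.
  (* Short values are below the minimum. *)
  have long : a <= 'C(y.+1, 2).
    rewrite leqNgt; apply/negP=> short; have := vJM_lt short.
    by move: lt_k; rewrite /UJM ifN -?ltnNge //; lia.
  move: lt_k; rewrite /UJM long => lt_k.
  have [le_bck|lt_kbc] := leqP (b + c) k.
    (* Lowering only the smallest pile does not decrease the reduced height, so the option stays
       long. *)
    exists (pos3 i j (k - (b + c)) b c).
      by apply: move_pos3 u3 _ _ _ _ _; lia.
    have le_y : y <= b + c - 2 * (k - (b + c)) by lia.
    rewrite (@value3_pos3 _ _ l _ _ _ (k - (b + c))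
               (b + c - 2 * (k - (b + c)))) //; try lia.
    by rewrite /UJM ifT; [lia | have := leq_bin2S le_y; lia].
  have [le_ck|lt_kc] := leqP c k.
    (* Here and below, an emptied pile makes the minimum 0, so that the value is the total. *)
    exists (pos3 i j 0 (k - c) c); first by apply: move_pos3 u3 _ _ _ _ _; lia.
    by rewrite (@value3_pos3 _ _ l _ _ _ 0 k) //; rewrite /UJM /=; lia.
  exists (pos3 i j a 0 (k - a)); first by apply: move_pos3 u3 _ _ _ _ _; lia.
  by rewrite (@value3_pos3 _ _ l _ _ _ 0 k) //; rewrite /UJM /=; lia.
have [z [r [ek le_rz]]] := triangular_decomposition k.
have := @vJM_shift a z r; rewrite -ek => /(_ lt_ka le_rz).
set d := _ %% _ => -[le_dz lt_kd vk].
(* This makes pile [l] drop strictly when pile [j] is kept. If [y <= z] then [x] is short, comparing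
   blocks gives [z = y], and [d = 0] would make [k] the value of [x] itself. *)
have zy : z < y + 2 * d.
  have [lt_zy|le_yz] := ltnP z y; first by lia.
  have le_bin := leq_bin2S le_yz; move: lt_k.
  rewrite /UJM ifN -?ltnNge; last by lia.
  move=> lt_kv; have := vJM_bounds a y.
  have [lt_yz|le_zy] := ltnP y z.
    by have := leq_bin2S lt_yz; rewrite binS2; lia.
  have e : z = y by lia.
  case: (posnP d) => [d0|]; last by lia.
  by move: vk lt_kv; rewrite d0 subn0 e => ->; rewrite ltnn.
have short : 'C(z.+1, 2) < a - d by lia.
have UE s : UJM (a - d) z s = k by rewrite /UJM ifN -?ltnNge.
(* The target has minimum [a - d] and total [z + 3 * (a - d)]. Pile [j] is kept if its excess over
   [a - d] fits within [z]; otherwise pile [i] is kept. *)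
have [le_bz|lt_zb] := leqP (d + (b - a)) z.
  exists (pos3 i j (a - d) b (a - d + (z - (d + (b - a))))).
    by apply: move_pos3 u3 _ _ _ _ _; lia.
  by rewrite (@value3_pos3 _ _ l _ _ _ (a - d) z) //; lia.
exists (pos3 i j a (a - d + (z - d)) (a - d)).
  by apply: move_pos3 u3 _ _ _ _ _; lia.
by rewrite (@value3_pos3 _ _ l _ _ _ (a - d) z) //; lia.
Qed.

Lemma proper3_JM : JM proper3.
Proof.
move=> x; rewrite JM_value3.
exact: grundy_unique value3_move_neq value3_option x.
Qed.

(** * The balanced hypergraph on eight vertices *)

(** Turns cardinals of concrete vertex sets into counts that evaluate by computation. *)
Lemma card_ord_pred n (p : pred nat) :
  #|[set i : 'I_n | p i]| = count p (iota 0 n).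
Proof.
by rewrite cardsE cardE size_filter -val_enum_ord count_map enumT.
Qed.

Lemma sum_mem_card (T : finType) (H S : {set T}) :
  \sum_(i in H) (i \in S) = #|H :&: S|.
Proof.
rewrite -sum1_card [RHS](eq_bigl (fun i => (i \in H) && (i \in S))).
  by rewrite [RHS]big_mkcondr; apply: eq_bigr => i _; case: (i \in S).
by move=> i; rewrite inE.
Qed.

Lemma card_swap (T : finType) (H S : {set T}) a b : a \in H -> b \notin H ->
  #|(b |: (H :\ a)) :&: S| + (a \in S) = #|H :&: S| + (b \in S).
Proof.
move=> aH bH; rewrite -!sum_mem_card (big_setD1 a aH) /= big_setU1 /=.
  by rewrite [_ + (b \in S)]addnC addnA addnAC.
by rewrite !inE (negbTE bH) andbF.
Qed.

Definition O8 := [set i : 'I_8 | (i : nat) == 0].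
Definition Z8 := [set i : 'I_8 | 0 < i < 4].
Definition W8 := [set i : 'I_8 | 3 < i].

Lemma card_O8 : #|O8| = 1. Proof. exact: (card_ord_pred _ (pred1 0)). Qed.
Lemma card_Z8 : #|Z8| = 3.
Proof. exact: (card_ord_pred _ (fun i => 0 < i < 4)). Qed.

Lemma card_W8 : #|W8| = 4.
Proof. exact: (card_ord_pred _ (fun i => 3 < i)). Qed.

Lemma card_OZW (H : {set 'I_8}) :
  #|H| = #|H :&: O8| + #|H :&: Z8| + #|H :&: W8|.
Proof.
rewrite -!sum_mem_card -!big_split -sum1_card; apply: eq_bigr => i _.
by rewrite !inE; case: i => [[|[|[|[|i]]]]].
Qed.

Definition bal8_edges : {set {set 'I_8}} :=
  [set H : {set 'I_8} |
    (#|H| == 4) && (#|H :&: O8| < #|H :&: W8| <= #|H :&: O8|.+2)].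

(** For [v] in [W8] these are exactly the edges that meet [W8] only once. *)
Definition star8 (v : nat) := [set i : 'I_8 | (0 < i < 4) || (i == v :> nat)].

Lemma star8_edge v : 3 < v < 8 -> star8 v \in bal8_edges.
Proof.
move=> vP; have sI (p : pred nat) :
    #|star8 v :&: [set i : 'I_8 | p i]| =
    count (fun i => ((0 < i < 4) || (i == v)) && p i) (iota 0 8).
  by rewrite -card_ord_pred; apply: eq_card => i; rewrite !inE.
rewrite inE card_OZW (sI (fun i => 0 < i < 4)).
rewrite (sI (fun i => i == 0)) (sI (fun i => 3 < i)).
by case: v vP {sI} => [|[|[|[|[|[|[|[|]]]]]]]].
Qed.

(** As [O8] has 1 vertex and [W8] has 4, complementation interchanges the two inequalities. *)
Lemma bal8_setC H : H \in bal8_edges -> ~: H \in bal8_edges.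
Proof.
have cI S : #|~: H :&: S| + #|H :&: S| = #|S|.
  by rewrite addnC ![_ :&: S]setIC -setDE cardsID.
rewrite !inE; have := cardsC H; rewrite card_ord.
have := cI O8; have := cI W8; rewrite card_O8 card_W8; lia.
Qed.

Fact bal8_vertices : 0 < #|'I_8|. Proof. by rewrite card_ord. Qed.

Fact bal8_nonempty : set0 \notin bal8_edges.
Proof. by rewrite inE cards0. Qed.

Fact bal8_cover : cover bal8_edges = [set: 'I_8].
Proof.
apply/setP=> i; rewrite inE; apply/bigcupP.
have [i0|i_gt0] := posnP i.
  exists (~: star8 4); first exact/bal8_setC/star8_edge.
  by rewrite !inE i0.
exists (star8 (maxn 4 i)); first by apply: star8_edge; have := ltn_ord i; lia.
by rewrite inE; lia.
Qed.

Definition bal8 : hypergraph 'I_8 :=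
  Hypergraph bal8_vertices bal8_nonempty bal8_cover.

Lemma bal8_condA : condA bal8.
Proof.
apply: (@condA_self_complementary _ _ 4); first by rewrite card_ord.
move=> H HG; split; last exact: bal8_setC.
by move: HG; rewrite inE => /andP[/eqP].
Qed.

(** The letters [c], [d], [e] count vertices in both edges, in [H] only and in [H'] only. Swaps
    within [W8] or within [Z8] are always legal. At the lower bound a swap raising the [W8] count
    minus the [O8] count is found, at the upper bound one lowering it. *)
Lemma exchange_arith (cO cZ cW dO dZ dW eO eZ eW : nat) :
    cO + dO + (cZ + dZ) + (cW + dW) = 4 -> cO + eO + (cZ + eZ) + (cW + eW) = 4 ->
    cO + dO < cW + dW <= (cO + dO).+2 -> cO + eO < cW + eW <= (cO + eO).+2 ->
    dO + eO <= 1 -> 0 < dO + dZ + dW ->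
  [\/ 0 < dW /\ 0 < eW, 0 < dZ /\ 0 < eZ,
      cW + dW = (cO + dO).+1 /\ (0 < dZ /\ 0 < eW \/ 0 < dO /\ 0 < eZ)
    | cW + dW = (cO + dO).+2 /\ (0 < dW /\ 0 < eZ \/ 0 < dZ /\ 0 < eO)].
Proof.
move=> hd he /andP[d1 d2] /andP[e1 e2] dO1 d0.
case: (posnP dW) => dW0; case: (posnP eW) => eW0; try by constructor 1.
all: case: (posnP dZ) => dZ0; case: (posnP eZ) => eZ0; try by constructor 2.
all: have [f1|f2] : cW + dW = (cO + dO).+1 \/ cW + dW = (cO + dO).+2 by lia.
all: try by exfalso; lia.
all: try by (constructor 3; split; [done | left; split; lia]).
all: try by (constructor 3; split; [done | right; split; lia]).
all: try by (constructor 4; split; [done | left; split; lia]).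
all: try by (constructor 4; split; [done | right; split; lia]).
Qed.

Lemma O8P i : i \in O8 -> (i \in O8 = true) * (i \in W8 = false).
Proof. by rewrite !inE => /eqP->. Qed.

Lemma Z8P i : i \in Z8 -> (i \in O8 = false) * (i \in W8 = false).
Proof. by rewrite !inE => /andP[i0 i4]; split; lia. Qed.

Lemma W8P i : i \in W8 -> (i \in O8 = false) * (i \in W8 = true).
Proof. by rewrite !inE => i3; split; lia. Qed.

Lemma bal8_condC : condC bal8.
Proof.
apply: (@condC_exchange _ _ 4) => // [H|H H' HG H'G neqHH'].
  by rewrite inE => /andP[/eqP].
pose D := H :\: H'; pose D' := H' :\: H.
(* The last hypothesis is the edge condition after swapping [a] for [b], with the removed vertex
   moved across to avoid subtraction. *)
have pick S S' : 0 < #|D :&: S| -> 0 < #|D' :&: S'| ->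
    (forall a b : 'I_8, a \in S -> b \in S' ->
       #|H :&: O8| + (b \in O8) + (a \in W8) <
       #|H :&: W8| + (b \in W8) + (a \in O8) <=
       (#|H :&: O8| + (b \in O8) + (a \in W8)).+2) ->
    exists a b, [/\ a \in H :\: H', b \in H' :\: H
                  & b |: (H :\ a) \in edges bal8].
  move=> /card_gt0P[a /setIP[aD aS]] /card_gt0P[b /setIP[bD bS]] /(_ a b aS bS).
  move: (aD) (bD); rewrite !in_setD => /andP[_ aH] /andP[bH _] ok.
  exists a, b; split=> //; rewrite inE.
  have := card_swap O8 aH bH; have := card_swap W8 aH bH.
  have := card_swap setT aH bH; rewrite !setIT !in_setT.
  move: HG ok; rewrite inE; set K := b |: _; clear.
  move: #|H| #|H :&: O8| #|H :&: W8| #|K| #|K :&: O8| #|K :&: W8| => h o w k o' w'.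
  move: (a \in O8) (b \in O8) (a \in W8) (b \in W8) => aO bO aW bW.
  by lia.
have ID S : #|H :&: S| = #|H :&: H' :&: S| + #|D :&: S|.
  by rewrite -(cardsID H' (H :&: S)) setIAC setIDAC.
have ID' S : #|H' :&: S| = #|H :&: H' :&: S| + #|D' :&: S|.
  by rewrite -(cardsID H (H' :&: S)) setIAC [H' :&: H]setIC setIDAC.
have DO : #|D :&: O8| + #|D' :&: O8| <= 1.
  rewrite -[leqRHS]card_O8 -(cardsID D O8) setIC leq_add2l.
  apply: subset_leq_card.
  by apply/subsetP=> i; rewrite !inE; case: (i \in H'); case: (i \in H).
have D_gt0 : 0 < #|D :&: O8| + #|D :&: Z8| + #|D :&: W8|.
  rewrite -card_OZW lt0n cards_eq0 setD_eq0; apply: contra neqHH' => sub.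
  rewrite eqEcard sub; move: HG H'G; rewrite !inE.
  by move=> /andP[/eqP-> _] /andP[/eqP-> _].
move: (HG) (H'G); rewrite !inE => /andP[/eqP cH hw] /andP[/eqP cH' hw'].
have := @exchange_arith #|H :&: H' :&: O8| #|H :&: H' :&: Z8| #|H :&: H' :&: W8|
  #|D :&: O8| #|D :&: Z8| #|D :&: W8| #|D' :&: O8| #|D' :&: Z8| #|D' :&: W8|.
rewrite -!ID -!ID' -!card_OZW => /(_ cH cH' hw hw' DO).
rewrite card_OZW => /(_ D_gt0).
case=> [[p q]|[p q]|[r [[p q]|[p q]]]|[r [[p q]|[p q]]]]; apply: pick p q _ => a b.
- by move=> /W8P[-> ->] /W8P[-> ->]; rewrite !addn0 !addn1.
- by move=> /Z8P[-> ->] /Z8P[-> ->]; rewrite !addn0.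
- by move=> /Z8P[-> ->] /W8P[-> ->]; rewrite r !addn0 !addn1 ltnW /=.
- by move=> /O8P[-> ->] /Z8P[-> ->]; rewrite r !addn0 !addn1 ltnW /=.
- by move=> /W8P[-> ->] /Z8P[-> ->]; rewrite r !addn0 !addn1 ltnSn ltnW.
- by move=> /Z8P[-> ->] /O8P[-> ->]; rewrite r !addn0 !addn1 ltnSn ltnW.
Qed.

(** * Weights, and the critical position [x8] *)

Lemma bal8_weight H : H \in edges bal8 -> 1 <= \sum_(i in H) (i \in W8).
Proof. by rewrite sum_mem_card inE => /andP[_ /andP[/(leq_ltn_trans _)->]]. Qed.

(** An edge missing a vertex of [Z8] meets [W8] at least twice. *)
Lemma bal8_weightZ z H : z \in Z8 -> H \in edges bal8 ->
  2 <= \sum_(i in H) ((i \in W8) + (i \in [set z])).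
Proof.
move=> zZ HG; rewrite big_split /= !sum_mem_card.
have [zH|zH] := boolP (z \in H).
  have := bal8_weight HG; rewrite sum_mem_card => w1.
  by apply: (leq_add w1); apply/card_gt0P; exists z; rewrite !inE zH eqxx.
have : #|H :&: Z8| < #|Z8|.
  apply: proper_card; apply/properP; split; first exact: subsetIr.
  by exists z; rewrite // in_setI (negbTE zH).
rewrite card_Z8; move: HG; rewrite inE card_OZW.
move: #|H :&: O8| #|H :&: Z8| #|H :&: W8| #|H :&: [set z]| => o n w s.
by move=> /andP[/eqP ? /andP[? ?]] ?; lia.
Qed.

Definition x8 : position 'I_8 :=
  [ffun i : 'I_8 => if i == 0 :> nat then 7 else if i < 4 then 32 else 8].

Lemma minpos_x8 : minpos x8 = 7.
Proof.
apply: (minpos_eq bal8 (i := ord0)) => [j|]; rewrite ffunE //.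
by case: eqP => // _; case: ifP.
Qed.

Lemma sum_W8 : \sum_i (i \in W8) = 4.
Proof.
have := sum_mem_card [set: 'I_8] W8; rewrite setTI card_W8; apply: etrans.
by apply: eq_bigl => i; rewrite inE.
Qed.

Lemma wsum_x8 : wsum (fun i => i \in W8) x8 = 32.
Proof.
rewrite /wsum (eq_bigr (fun i : 'I_8 => (i \in W8) * 8)).
  by rewrite -big_distrl /= sum_W8.
by move=> i _; rewrite ffunE inE; case: i => [[|[|[|[|i]]]]].
Qed.

(** Playing each of the four stars [n] times uses every vertex of [Z8] [4 * n] times, every vertex
    of [W8] [n] times, and never [ord0]. *)
Lemma height_stars8 n (x : position 'I_8) :
    (forall i : 'I_8, 0 < i < 4 -> 4 * n <= x i) ->
    (forall i : 'I_8, 3 < i -> n <= x i) ->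
  4 * n <= height bal8 x.
Proof.
move=> xZ xW.
pose p := nseq n (star8 4) ++ nseq n (star8 5) ++ nseq n (star8 6)
            ++ nseq n (star8 7).
rewrite (_ : 4 * n = size p); last by rewrite /p !size_cat !size_nseq; lia.
apply: height_packing.
  by rewrite !all_cat !all_nseq !star8_edge // !orbT.
move=> i; rewrite !count_cat !count_nseq !inE -!mulnDl.
have [iZ|iZ] := boolP (0 < i < 4); first exact: xZ.
have [iW|iW] := boolP (3 < i).
  rewrite (_ : _ + _ = 1) ?mul1n ?xW //; have := ltn_ord i; clear -iW; lia.
by rewrite (_ : _ + _ = 0) //; clear -iZ iW; lia.
Qed.

Lemma height_x8 : height bal8 x8 = 32.
Proof.
apply/eqP; rewrite eqn_leq; apply/andP; split.
  by have := height_wsum x8 bal8_weight; rewrite wsum_x8 muln1.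
apply: (@height_stars8 8) => i iP; rewrite ffunE.
  by case: i iP => [[|[|[|[|]]]]].
by case: i iP => [[|[|[|[|]]]]].
Qed.

Lemma reduced_height_x8 : 4 <= reduced_height bal8 x8.
Proof.
apply: (@height_stars8 1) => i iP; rewrite ffunE minpos_x8 ffunE.
  by case: i iP => [[|[|[|[|]]]]].
by case: i iP => [[|[|[|[|]]]]].
Qed.

(* Every option of height at least 31 is played on some [star8 v]: the weight
   [W8] allows only one vertex of [W8] in the edge, which excludes [ord0], and
   the weights [W8] plus a vertex of [Z8] bound the other coordinates below. *)
Lemma x8_option y : move bal8 x8 y -> 31 <= height bal8 y ->
  minpos y = 7 /\ reduced_height bal8 y <= 3.
Proof.
move=> mxy hy; have le_yx i := move_le i mxy.
have [H HG Hxy] := moveP _ _ _ mxy.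
set w := fun i : 'I_8 => (i \in W8 : nat).
have wy : 31 <= wsum w y.
  by apply: leq_trans hy _; have := height_wsum y bal8_weight; rewrite muln1.
have wH : wsum w y + #|H :&: W8| <= 32.
  by have := wsum_move w Hxy; rewrite sum_mem_card wsum_x8.
have oH : ord0 \notin H.
  apply/negP=> oH; move: HG; rewrite inE => /andP[_ /andP[+ _]].
  have : 0 < #|H :&: O8| by apply/card_gt0P; exists ord0; rewrite inE oH inE.
  by move: wy wH; move: (wsum w y) #|_| #|_| => a b c; lia.
have y0 : y ord0 = 7.
  by have := Hxy ord0; rewrite (negbTE oH) => /eqP->; rewrite ffunE.
have w1 : 0 < #|H :&: W8| by have := bal8_weight HG; rewrite sum_mem_card.
have wy31 : wsum w y = 31.
  by move: wy wH w1; move: (wsum w y) #|_| => a b; lia.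
(* [W8] loses a single token in all, from piles of 8. *)
have yW i : i \in W8 -> 7 <= y i.
  move=> iW; have := wsum_le_point w i le_yx; rewrite wy31 wsum_x8 /w iW !mul1n.
  have -> : x8 i = 8 by move: iW; rewrite inE ffunE; case: (i) => [[|[|[|[|]]]]].
  by rewrite -[31 + 8]/(32 + 7) leq_add2l.
(* The doubled weight bound reads [31 * 2 <= 31 + y z]. *)
have yZ z : z \in Z8 -> 7 <= y z.
  move=> zZ; have := height_wsum y (fun H => bal8_weightZ zZ (H := H)).
  rewrite (_ : wsum _ y = 31 + y z); first by move: hy; lia.
  by rewrite wsumD wsum_set1 -wy31.
have y7 i : 7 <= y i.
  have [iW|iW] := boolP (i \in W8); first exact: yW.
  have [iZ|iZ] := boolP (i \in Z8); first exact: yZ.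
  rewrite (_ : i = ord0) ?y0 //; apply/val_inj; move: iW iZ; rewrite !inE.
  by case: (i) => [[|[|[|[|]]]]].
have my : minpos y = 7 by apply: (minpos_eq bal8 (i := ord0)).
split=> //; rewrite /reduced_height my.
have := height_wsum [ffun i => y i - 7] bal8_weight.
rewrite muln1 => /leq_trans; apply.
have := wsum_sub w y7; rewrite sum_W8 wy31 -[31]/(3 + 4 * 7).
by move/addIn=> ->.
Qed.

Lemma bal8_not_condB : ~ condB bal8.
Proof.
move=> /(_ x8); rewrite minpos_x8 height_x8 => /(_ isT)[y [mxy lt_m hy _]].
by have [] := x8_option mxy; rewrite ?hy // => my; rewrite my ltnn in lt_m.
Qed.

Lemma bal8_not_JM : ~ JM bal8.
Proof.
(* Reduced height at least 4 gives a threshold of at least 10, above the minimum 7, so the predicted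
   value is the height 32. *)
move=> jm; have := jm x8; rewrite minpos_x8 height_x8 /UJM ifT => [gx|]; last first.
  by apply: leq_trans (leq_bin2S reduced_height_x8).
have [y mxy gy] : exists2 y, move bal8 x8 y & grundy bal8 y = 31.
  by apply: grundy_option; rewrite gx.
have [|my ry] := x8_option mxy; first by rewrite -gy grundy_le_height.
(* Reduced height at most 3 gives a threshold of at most 6, so the JM value of [y] is at most 6 + 3,
   far from 31. *)
have := leq_bin2S ry => /leq_ltn_trans/(_ (isT : 6 < 7)).
rewrite ltnNge => /negbTE short; move: gy; rewrite jm my /UJM short => e.
have := vJM_bounds 7 (reduced_height bal8 y); rewrite e => /andP[_].
by case: (reduced_height _ _) ry => [|[|[|[|]]]].
Qed.

Theorem theorem4 :
  (* (P1) *)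
  ([/\ exists (V : finType) (G : hypergraph V), condA G /\ ~ JM G,
       exists (V : finType) (G : hypergraph V), condA G /\ ~ condB G
     & exists (V : finType) (G : hypergraph V), condA G /\ ~ condC G]) /\
  (* (P2) *)
  ((exists (V : finType) (G : hypergraph V), condB G /\ ~ condA G) /\
   (exists (V : finType) (G : hypergraph V), condB G /\ ~ condC G)) /\
  (* (P3) *)
  ((exists (V : finType) (G : hypergraph V), condC G /\ ~ condA G) /\
   (exists (V : finType) (G : hypergraph V), condC G /\ ~ condB G)) /\
  (* (P4) *)
  ((exists (V : finType) (G : hypergraph V), [/\ condA G, condB G & ~ JM G]) /\
   (exists (V : finType) (G : hypergraph V), [/\ condA G, condB G & ~ condC G])) /\
  (* (P5) *)
  ((exists (V : finType) (G : hypergraph V), [/\ condB G, condC G & ~ JM G]) /\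
   (exists (V : finType) (G : hypergraph V), [/\ condB G, condC G & ~ condA G])) /\
  (* (P6) *)
  ((exists (V : finType) (G : hypergraph V), [/\ condA G, condC G & ~ JM G]) /\
   (exists (V : finType) (G : hypergraph V), [/\ condA G, condC G & ~ condB G])) /\
  (* (P7) *)
  (exists (V : finType) (G : hypergraph V), [/\ JM G, condB G & ~ condC G]).
Proof.
have nim1B : condB nim1 := condB_singletons (nim_singletons _).
have nim2B : condB nim2 := condB_singletons (nim_singletons _).
have nim2C : ~ condC nim2.
  exact: (not_condC_singletons (nim_singletons _) (isT : true != false)).
have proper3B : condB proper3 := @condB_singletons _ proper3 proper3_singletons.
have proper3C : ~ condC proper3.
  exact: (@not_condC_singletons _ proper3 proper3_singletons ord0 ord_max isT).
have bA := bal8_condA; have bC := bal8_condC.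
have bB := bal8_not_condB; have bJ := bal8_not_JM.
have nA := nim2_condA; have nJ := nim2_not_JM.
have oA := nim1_not_condA; have oC := nim1_condC; have oJ := nim1_not_JM.
split; first by split; [exists bool, nim2 | exists 'I_8, bal8 | exists bool, nim2].
split; first by split; [exists unit, nim1 | exists bool, nim2].
split; first by split; [exists unit, nim1 | exists 'I_8, bal8].
split; first by split; exists bool, nim2.
split; first by split; exists unit, nim1.
split; first by split; exists 'I_8, bal8.
by exists 'I_3, proper3; split=> //; apply: proper3_JM.
Qed.
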